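(* Let $A=\{x_1,x_2\}$ be an alphabet of two variables. For every positive integer $n$, $$\sum_{\substack{0\le k\le n\\ k\equiv n\ (\mathrm{mod}\ 2)}}\binom{n}{k}(x_1-x_2)^{n-k}\left(2^k\phi_k(x_1+x_2)-2(x_1+x_2)^k\right)B_{n-k}=n2^{n-2}(x_1-x_2)^2S_{n-2}(x_1+x_2),$$ $$\sum_{\substack{0\le k\le n\\ k\equiv n\ (\mathrm{mod}\ 2)}}\binom{n}{k}(x_1-x_2)^{n-k}(1-2^{n-k})\left(2^k\phi_k(x_1+x_2)+2(x_1+x_2)^k\right)B_{n-k}=-n2^{n-2}(x_1-x_2)^2S_{n-2}(x_1+x_2).$$
   Context: Here $x_1,x_2$ are two commuting variables (indeterminates) and identities are in the field of rational functions in them. The notation $S_n(x_1+x_2)$, $\phi_n(x_1+x_2)$ denotes functions of the alphabet $\{x_1,x_2\}$ (not functions of the sum): $S_n(x_1+x_2)=\dfrac{x_1^{n+1}-x_2^{n+1}}{x_1-x_2}$ for $n\ge 0$, with $S_n(x_1+x_2)=0$ for $n<0$, and $\phi_n(x_1+x_2)=x_1^n+x_2^n$ for $n\ge 0$. The expression $(x_1+x_2)^k$ is the ordinary power of the sum. The Bernoulli numbers $B_n$ are defined by $\sum_{n\ge 0}B_n\frac{z^n}{n!}=\frac{z}{e^z-1}$ (so $B_1=-\tfrac12$). *)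

(* Defs.v *)
From HB Require Import structures.
From mathcomp Require Import all_boot all_order all_algebra.
From mathcomp Require Import mpoly.
Set Implicit Arguments.
Unset Strict Implicit.
Unset Printing Implicit Defensive.
Import GRing.Theory.
Local Open Scope ring_scope.

(* A formal power series over K is given by its sequence of coefficients. *)
Definition fps (K : fieldType) : Type := nat -> K.

Definition fps_mul (K : fieldType) (a b : fps K) : fps K :=
  fun n => \sum_(k < n.+1) a k * b (n - k)%N.

Definition fps_z (K : fieldType) : fps K := fun n => (n == 1%N)%:R.

Definition egf (K : fieldType) (a : nat -> K) : fps K := fun n => a n / (n`!)%:R.

(* The series e^z - 1. *)
Definition fps_expm1 (K : fieldType) : fps K :=
  fun n => egf (fun=> 1) n - (n == 0%N)%:R.

(* (\sum_n B_n z^n / n!) (e^z - 1) = z in K[[z]]; since e^z - 1 is not a zero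
   divisor this says that \sum_n B_n z^n / n! = z / (e^z - 1). *)
Definition is_bernoulli (K : fieldType) (B : nat -> K) : Prop :=
  forall n, fps_mul (egf B) (fps_expm1 K) n = fps_z K n.

Definition ratfun (K : fieldType) : fieldType := {fraction {mpoly K[2]}}.

Definition ratfun_const (K : fieldType) (c : K) : ratfun K :=
  FracField.tofrac (c%:MP_[2] : {mpoly K[2]}).

Definition ratfun_x1 (K : fieldType) : ratfun K :=
  FracField.tofrac ('X_(ord0 : 'I_2) : {mpoly K[2]}).

Definition ratfun_x2 (K : fieldType) : ratfun K :=
  FracField.tofrac ('X_(ord_max : 'I_2) : {mpoly K[2]}).

(* S_n and phi_n of the alphabet {x1, x2}; the index of S ranges over int
   because S_n = 0 for n < 0 is part of the definition. *)
Definition symS (F : fieldType) (n : int) (x1 x2 : F) : F :=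
  match n with
  | Posz m => (x1 ^+ m.+1 - x2 ^+ m.+1) / (x1 - x2)
  | Negz _ => 0
  end.

Definition symphi (F : fieldType) (n : nat) (x1 x2 : F) : F := x1 ^+ n + x2 ^+ n.

Section Bernoulli.
Variables (K : fieldType) (charK : [pchar K] =i pred0).

Lemma fact_neq0 n : (n`!)%:R != 0 :> K.
Proof. by rewrite (iffLR (pcharf0P _) charK) -lt0n fact_gt0. Qed.

Lemma fps_expm1_0 : fps_expm1 K 0 = 0.
Proof. by rewrite /fps_expm1 /egf fact0 divr1 subrr. Qed.

Lemma fps_mul_expm1S (b : fps K) n :
  fps_mul b (fps_expm1 K) n.+1
    = \sum_(k < n) b k * fps_expm1 K (n.+1 - k)%N + b n.
Proof.
rewrite /fps_mul 2!big_ord_recr /= subnn subSnn fps_expm1_0 mulr0 addr0.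
by rewrite /fps_expm1 /egf divr1 subr0 mulr1.
Qed.

Fixpoint bernoulli_coefs (n : nat) : seq K :=
  if n isn't m.+1 then [::]
  else let s := bernoulli_coefs m in
    rcons s ((m == 0%N)%:R
             - \sum_(k < m) s`_k * fps_expm1 K (m.+1 - k)%N).

Lemma size_bernoulli_coefs n : size (bernoulli_coefs n) = n.
Proof. by elim: n => //= n IHn; rewrite size_rcons IHn. Qed.

Lemma nth_bernoulli_coefs n k : (k < n)%N ->
  (bernoulli_coefs n)`_k = (bernoulli_coefs k.+1)`_k.
Proof.
elim: n => // n IHn; rewrite ltnS leq_eqVlt => /orP[/eqP-> //|lt_kn].
by rewrite [in LHS]/= nth_rcons size_bernoulli_coefs lt_kn IHn.
Qed.

Lemma bernoulli_exists : exists B : nat -> K, is_bernoulli B.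
Proof.
pose b k := (bernoulli_coefs k.+1)`_k.
exists (fun n => b n * (n`!)%:R) => -[|n].
  by rewrite /fps_mul big_ord1 fps_expm1_0 mulr0.
have eb k : egf (fun n => b n * (n`!)%:R) k = b k.
  by rewrite /egf mulfK ?fact_neq0.
rewrite fps_mul_expm1S eb {2}/b /= nth_rcons size_bernoulli_coefs ltnn eqxx.
rewrite [X in X + _](_ : _ = \sum_(k < n) (bernoulli_coefs n)`_k
                               * fps_expm1 K (n.+1 - k)%N); last first.
  by apply: eq_bigr => k _; rewrite eb nth_bernoulli_coefs.
by rewrite addrC subrK /fps_z eqSS.
Qed.

Lemma bernoulli_unique (B C : nat -> K) :
  is_bernoulli B -> is_bernoulli C -> B =1 C.
Proof.
move=> hB hC n; elim/ltn_ind: n => n IHn.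
have := etrans (hB n.+1) (esym (hC n.+1)); rewrite !fps_mul_expm1S.
rewrite [X in X + _ = _](_ : _ = \sum_(k < n) egf C k
                               * fps_expm1 K (n.+1 - k)%N); last first.
  by apply: eq_bigr => k _; rewrite /egf IHn.
move/addrI; rewrite /egf => /(congr1 (fun y => y * (n`!)%:R)).
by rewrite !mulfVK ?fact_neq0.
Qed.

End Bernoulli.

(* Main.v *)
Require Import Defs.
From HB Require Import structures.
From mathcomp Require Import all_boot all_order all_algebra.
From mathcomp Require Import mpoly.
From mathcomp Require Import ring.
Set Implicit Arguments.
Unset Strict Implicit.
Unset Printing Implicit Defensive.
Import GRing.Theory.
Local Open Scope ring_scope.

(** Write umbral b for the linear functional X^k |-> b_k on polynomials.  For
    b_k = B_k + [k = 1] / 2 the defining recurrence of the Bernoulli numbers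
    becomes umbral b (f(X+1) - f(X)) = (f'(0) + f'(1)) / 2.  As f(X+1) - f(X)
    ranges over all polynomials, this forces umbral b to be invariant under
    X |-> -X, so that b_k vanishes for odd k.  The sums of the theorem are then
    the values of umbral b, and of f |-> umbral b (f(X) - f(2X)), at
    g(X) -/+ 2 g(X+1) + g(X+2) with g = ((x1 - x2) X + 2 x2)^n; these
    values are +/- (g'(2) - g'(0)) / 2. *)

(** * Linear functionals on polynomials, given by their moments *)

Section UmbralFunctional.
Variable F : fieldType.
Implicit Types (b : nat -> F) (p q : {poly F}).

Lemma poly_linear_ind (P : {poly F} -> Prop) :
    (forall c p q, P p -> P q -> P (c *: p + q)) -> (forall n, P 'X^n) ->
  forall p, P p.
Proof.
move=> Plin PX p; have P0 : P 0.
  by rewrite -(addNr 1) -scaleN1r; apply: Plin; exact: PX 0%N.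
rewrite -[p]coefK poly_def; elim/big_rec: _ => // i q _ Pq.
exact: Plin.
Qed.

Definition umbral b p : F := \sum_(i < size p) p`_i * b i.

Lemma umbral_widen b p n : (size p <= n)%N ->
  umbral b p = \sum_(i < n) p`_i * b i.
Proof.
move=> le_pn; rewrite /umbral (big_ord_widen n (fun i => p`_i * b i)) //.
rewrite big_mkcond; apply: eq_bigr => i _; case: ltnP => // le_pi.
by rewrite nth_default ?mul0r.
Qed.

Lemma umbral_is_linear b : scalar (umbral b).
Proof.
move=> c p q; pose n := maxn (size p) (size q).
rewrite !(@umbral_widen b _ n) ?leq_maxl ?leq_maxr //; last first.
  apply: leq_trans (size_polyD _ _) _; rewrite geq_max leq_maxr andbT.
  exact: leq_trans (size_scale_leq _ _) (leq_maxl _ _).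
rewrite mulr_sumr -big_split; apply: eq_bigr => i _ /=.
by rewrite coefD coefZ mulrDl mulrA.
Qed.

HB.instance Definition _ b :=
  GRing.isLinear.Build F {poly F} F _ (umbral b) (umbral_is_linear b).

Lemma umbralXn b n : umbral b 'X^n = b n.
Proof.
rewrite /umbral size_polyXn big_ord_recr /= coefXn eqxx mul1r big1 ?add0r //.
by move=> i _; rewrite coefXn ltn_eqF ?mul0r.
Qed.

Lemma umbral_affine_exp b (c a : F) n :
  umbral b ((c *: 'X + a%:P) ^+ n) =
  \sum_(k < n.+1) 'C(n, k)%:R * c ^+ (n - k) * a ^+ k * b (n - k)%N.
Proof.
rewrite exprDn linear_sum; apply: eq_bigr => k _.
rewrite -polyC_exp mulrC mul_polyC exprZn scalerA -scaler_nat scalerA.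
by rewrite linearZ /= umbralXn; congr (_ * _); rewrite -mulrA (mulrC (c ^+ _)).
Qed.

(** * The shift and difference operators *)

Definition shift p : {poly F} := p \Po ('X + 1).

Lemma shift_is_linear : linear shift.
Proof. by move=> c p q; rewrite /shift linearP. Qed.

HB.instance Definition _ :=
  GRing.isLinear.Build F {poly F} {poly F} _ shift shift_is_linear.

Lemma horner_shift p x : (shift p).[x] = p.[x + 1].
Proof. by rewrite horner_comp !hornerE. Qed.

Lemma deriv_shift p : (shift p)^`() = shift p^`().
Proof. by rewrite /shift deriv_comp derivD derivX derivC addr0 mulr1. Qed.

Lemma shift_subXn n :
  shift 'X^n - 'X^n = \sum_(k < n) 'C(n, k)%:R *: 'X^k.
Proof.
rewrite /shift comp_Xn_poly (addrC 'X) exprDn big_ord_recr /= subnn expr0 mul1r.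
rewrite binn mulr1n addrK; apply: eq_bigr => k _.
by rewrite expr1n mul1r scaler_nat.
Qed.

Hypothesis charF : [pchar F] =i pred0.

Lemma natf_neq0_char0 n : n.+1%:R != 0 :> F.
Proof. by rewrite (iffLR (pcharf0P _) charF). Qed.

(** The difference of ['X^(n.+1)] is [n.+1] times ['X^n] plus lower powers, which are differences by
    strong induction; characteristic zero allows division by [n.+1]. *)
Lemma shift_sub_surj p : exists q, p = shift q - q.
Proof.
have lin c p1 p2 : (exists q, p1 = shift q - q) ->
    (exists q, p2 = shift q - q) -> exists q, c *: p1 + p2 = shift q - q.
  move=> [q1 ->] [q2 ->]; exists (c *: q1 + q2).
  by rewrite linearP /= scalerBr opprD addrACA.
elim/poly_linear_ind: p => // n; elim/ltn_ind: n => n IHn.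
have [q defq] : exists q, \sum_(k < n) 'C(n.+1, k)%:R *: 'X^k = shift q - q.
  elim/big_rec: _ => [|k p _ IHp]; last by apply: lin IHp; apply: IHn.
  by exists 0; rewrite linear0 subr0.
exists (n.+1%:R^-1 *: ('X^(n.+1) - q)).
rewrite linearZ linearB /= -scalerBr.
have -> : shift 'X^(n.+1) - shift q - ('X^(n.+1) - q)
        = (shift 'X^(n.+1) - 'X^(n.+1)) - (shift q - q).
  by ring.
rewrite shift_subXn big_ord_recr /= defq addrAC subrr add0r binSn.
by rewrite scalerA mulVf ?scale1r ?natf_neq0_char0.
Qed.

(** * Bernoulli numbers and their symmetric variant *)

Section Bernoulli.
Variable B : nat -> F.
Hypothesis sumB : forall n, \sum_(k < n) 'C(n, k)%:R * B k = (n == 1%N)%:R.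

Lemma umbral_bernoulli_shift p : umbral B (shift p - p) = p^`().[0].
Proof.
elim/poly_linear_ind: p => [c p q IHp IHq | n].
  rewrite linearP /= opprD addrACA -scalerBr linearP /= IHp IHq.
  by rewrite linearP /= hornerD hornerZ.
rewrite shift_subXn linear_sum.
under eq_bigr do rewrite linearZ /= umbralXn.
rewrite sumB derivXn hornerMn hornerXn.
by case: n => [|[|n]] //=; rewrite exprS mul0r mul0rn.
Qed.

(** As [sumB] forces B_1 = -1/2, the correction makes the entry at 1 vanish, like those at all other
    odd indices. *)
Definition bernoulli_sym n : F := B n + (n == 1%N)%:R / 2.

Lemma umbral_sym p : umbral bernoulli_sym p = umbral B p + p^`().[0] / 2.
Proof.
elim/poly_linear_ind: p => [c p q IHp IHq | n].
  rewrite !linearP /= IHp IHq hornerD hornerZ mulrDl mulrDr addrACA.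
  by rewrite !mulrA.
rewrite !umbralXn derivXn hornerMn hornerXn /bernoulli_sym.
by case: n => [|[|n]] //=; rewrite ?mulr0n ?mul0r // exprS mul0r mul0rn mul0r.
Qed.

(** The correction adds (p'(1) - p'(0)) / 2 to the value p'(0) obtained from [B]; the result is
    symmetric in 0 and 1. *)
Lemma umbral_sym_shift p :
  umbral bernoulli_sym (shift p - p) = (p^`().[0] + p^`().[1]) / 2.
Proof.
rewrite umbral_sym umbral_bernoulli_shift derivB deriv_shift hornerD hornerN.
rewrite horner_shift add0r.
by field; exact: natf_neq0_char0 1.
Qed.

Lemma bernoulli_sym_odd n : odd n -> bernoulli_sym n = 0.
Proof.
move=> odd_n.
have symN p : umbral bernoulli_sym (p \Po - 'X) = umbral bernoulli_sym p.
  (* Here r(X) = q(1 - X), so p(-X) = -(r(X+1) - r(X)). This sign cancels against the one in r'(X) =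
     -q'(1 - X), while the exchange of 0 and 1 is harmless. *)
  have [q ->] := shift_sub_surj p; pose r := shift q \Po - 'X.
  have shift_r : shift r = q \Po - 'X.
    rewrite /r /shift -!comp_polyA; congr (_ \Po _).
    rewrite !comp_polyD !comp_polyX !comp_polyC raddfN /= comp_polyX.
    by rewrite opprD addrNK.
  have -> : (shift q - q) \Po - 'X = - (shift r - r).
    by rewrite linearB /= shift_r opprB.
  rewrite linearN /= !umbral_sym_shift /r deriv_comp deriv_shift derivN derivX.
  rewrite !hornerM !horner_comp !hornerN !hornerX !hornerC.
  by rewrite !hornerE oppr0 add0r addNr; ring.
have := symN 'X^n; rewrite comp_Xn_poly exprNn -signr_odd odd_n expr1 mulN1r.
rewrite linearN /= umbralXn => /eqP; rewrite eq_sym -subr_eq0 opprK.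
by rewrite -mulr2n -mulr_natr mulf_eq0 (negPf (natf_neq0_char0 1)) orbF => /eqP.
Qed.

Lemma umbral_sym_scaled p :
  umbral (fun k => (1 - 2 ^+ k) * bernoulli_sym k) p =
  umbral bernoulli_sym p - umbral bernoulli_sym (p \Po (2 *: 'X)).
Proof.
elim/poly_linear_ind: p => [c p q IHp IHq | n].
  by rewrite !linearP /= IHp IHq; ring.
rewrite comp_Xn_poly exprZn linearZ /= !umbralXn; ring.
Qed.

(** If p = q(X+1) - q(X), then p(X+1) + p(X) = q(X+2) - q(X). Replacing X by 2X turns this into a
    unit-step difference of r(X) = q(2X), so [umbral_sym_shift] evaluates both terms of
    [umbral_sym_scaled]. *)
Lemma umbral_sym_scaled_shift p :
  umbral (fun k => (1 - 2 ^+ k) * bernoulli_sym k) (shift p + p) =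
  - ((p^`().[1] - p^`().[0]) / 2).
Proof.
have [q ->] := shift_sub_surj p; pose r := q \Po (2 *: 'X).
have shift_r : (shift (shift q)) \Po (2 *: 'X) = shift r.
  rewrite /r /shift -!comp_polyA; congr (_ \Po _).
  rewrite !comp_polyD !comp_polyX !comp_polyC linearZ /= comp_polyX.
  by rewrite scalerDr -addrA -[1 + 1]/(2%:R); congr (_ + _); rewrite scaler_nat.
have -> : shift (shift q - q) + (shift q - q)
        = (shift (shift q) - shift q) + (shift q - q) by rewrite linearB.
rewrite umbral_sym_scaled.
have -> : ((shift (shift q) - shift q) + (shift q - q)) \Po (2 *: 'X)
        = shift r - r.
  by rewrite addrA subrK linearB /= shift_r.
rewrite linearD /= !umbral_sym_shift /r !derivB !deriv_shift.
rewrite !(hornerD, hornerN) !horner_shift deriv_comp derivZ derivX.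
rewrite !hornerM !horner_comp !hornerE.
rewrite -[1 + 1]/(2%:R) /=.
by field; exact: natf_neq0_char0 1.
Qed.

(** For odd n - k the symmetric entry vanishes; for even n - k it equals that of [B], as the two
    differ only at index 1. *)
Lemma sum_same_parity n (u : nat -> F) :
  \sum_(0 <= k < n.+1 | k == n %[mod 2]) u k * B (n - k)%N =
  \sum_(k < n.+1) u k * bernoulli_sym (n - k)%N.
Proof.
rewrite big_mkcond big_mkord; apply: eq_bigr => -[k lt_kn] _ /=.
rewrite eq_sym eqn_mod_dvd // dvdn2; case: ifPn => [even_nk | odd_nk].
  by rewrite /bernoulli_sym; case: eqP even_nk => [->|]; rewrite ?mul0r ?addr0.
by rewrite bernoulli_sym_odd ?mulr0 //; case: odd odd_nk.
Qed.

(** * The two sums as umbral values of affine powers *)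

Lemma shift_affine_exp (c a : F) n :
  shift ((c *: 'X + a%:P) ^+ n) = (c *: 'X + (c + a)%:P) ^+ n.
Proof.
rewrite /shift rmorphXn /= comp_polyD comp_polyC linearZ /= comp_polyX.
by rewrite scalerDr polyCD addrA alg_polyC.
Qed.

Variables (x y : F) (n : nat).
Let d := x - y.
Let g := (d *: 'X + (2 * y)%:P) ^+ n.

(** Each shift adds x - y to the constant term, which runs through 2y, x + y, 2x: the outer two
    produce [2 ^+ k * symphi k x y], the middle one [(x + y) ^+ k]. *)
Lemma affine_exp_shift2 :
  (shift g = (d *: 'X + (x + y)%:P) ^+ n)
  * (shift (shift g) = (d *: 'X + (2 * x)%:P) ^+ n).
Proof.
rewrite /g !shift_affine_exp /d.
by split; congr ((_ + _%:P) ^+ _); ring.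
Qed.

Lemma deriv_affine_exp_diff :
  (g^`().[2] - g^`().[0]) / 2 =
  n%:R * d * ((2 * x) ^+ n.-1 - (2 * y) ^+ n.-1) / 2.
Proof.
rewrite /g deriv_exp derivD derivC derivZ derivX !hornerE /=.
rewrite !hornerMn !hornerE; congr (_ / 2).
have -> : d * 2 + 2 * y = 2 * x by rewrite /d; ring.
by rewrite -mulrnBl -mulr_natl; ring.
Qed.

Lemma bernoulli_sum_diff :
  \sum_(0 <= k < n.+1 | k == n %[mod 2])
    'C(n, k)%:R * d ^+ (n - k) * (2 ^+ k * symphi k x y - 2 * (x + y) ^+ k)
    * B (n - k)%N
  = n%:R * d * ((2 * x) ^+ n.-1 - (2 * y) ^+ n.-1) / 2.
Proof.
rewrite sum_same_parity -deriv_affine_exp_diff.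
transitivity (umbral bernoulli_sym (shift (shift g) - 2 *: shift g + g)).
  rewrite linearD linearB linearZ /= !affine_exp_shift2 /g !umbral_affine_exp.
  rewrite mulr_sumr -sumrB -big_split; apply: eq_bigr => k _ /=.
  by rewrite /symphi !exprMn; ring.
(* For p = g(X+1) - g(X), the sum p'(0) + p'(1) telescopes to g'(2) - g'(0). *)
have -> : shift (shift g) - 2 *: shift g + g
        = shift (shift g - g) - (shift g - g).
  by rewrite linearB /= scaler_nat; ring.
rewrite umbral_sym_shift !derivB !deriv_shift !(hornerD, hornerN).
rewrite !horner_shift add0r.
by rewrite -[1 + 1]/(2%:R); congr (_ / 2); ring.
Qed.

Lemma bernoulli_sum_add :
  \sum_(0 <= k < n.+1 | k == n %[mod 2])
    'C(n, k)%:R * d ^+ (n - k) * (1 - 2 ^+ (n - k))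
    * (2 ^+ k * symphi k x y + 2 * (x + y) ^+ k) * B (n - k)%N
  = - (n%:R * d * ((2 * x) ^+ n.-1 - (2 * y) ^+ n.-1) / 2).
Proof.
rewrite sum_same_parity -deriv_affine_exp_diff.
pose u k := (1 - 2 ^+ k) * bernoulli_sym k.
transitivity (umbral u (shift (shift g) + 2 *: shift g + g)).
  rewrite !linearD linearZ /= !affine_exp_shift2 /g !umbral_affine_exp.
  rewrite mulr_sumr -!big_split; apply: eq_bigr => k _ /=.
  by rewrite /symphi /u !exprMn; ring.
(* Now p = g(X+1) + g(X), and p'(1) - p'(0) is again g'(2) - g'(0). *)
have -> : shift (shift g) + 2 *: shift g + g
        = shift (shift g + g) + (shift g + g).
  by rewrite linearD /= scaler_nat; ring.
rewrite umbral_sym_scaled_shift !derivD !deriv_shift !hornerD !horner_shift.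
by rewrite add0r -[1 + 1]/(2%:R); congr (- (_ / 2)); ring.
Qed.

End Bernoulli.

Lemma symS_closed (x y : F) n : (0 < n)%N ->
  n%:R * 2 ^ (n%:Z - 2) * (x - y) ^+ 2 * symS (n%:Z - 2) x y =
  n%:R * (x - y) * ((2 * x) ^+ n.-1 - (2 * y) ^+ n.-1) / 2.
Proof.
(* For n = 1 the index of [symS] is -1 and both sides vanish. *)
case: n => // -[|n] _; first by rewrite /= mulr0 !expr0 subrr mulr0 mul0r.
have -> : (n.+2%:Z - 2 = n)%R by rewrite -addn2 PoszD addrK.
rewrite -exprnP /symS !exprMn.
(* If x = y, [symS] divides by zero, but both sides have a factor x - y. *)
have [-> | nz_d] := eqVneq (x - y) 0.
  by rewrite expr0n /= !(mulr0, mul0r).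
by rewrite (exprS 2 n); field; rewrite nz_d (natf_neq0_char0 1).
Qed.

End UmbralFunctional.

(** This is n! times the coefficient of z^n in the defining identity; the term k = n drops out
    because e^z - 1 has no constant term. *)
Lemma is_bernoulli_sum (K : fieldType) (charK : [pchar K] =i pred0)
    (B : nat -> K) (hB : is_bernoulli B) n :
  \sum_(k < n) 'C(n, k)%:R * B k = (n == 1%N)%:R.
Proof.
have := congr1 (fun c => n`!%:R * c) (hB n).
rewrite /fps_mul /fps_z big_ord_recr /= subnn fps_expm1_0 mulr0 addr0 mulr_sumr.
have -> : n`!%:R * (n == 1%N)%:R = (n == 1%N)%:R :> K.
  by case: n => [|[|n]]; rewrite ?mulr0 ?mulr1.
move=> <-; apply: eq_bigr => k _.
rewrite /fps_expm1 /egf subn_eq0 leqNgt ltn_ord subr0.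
rewrite -(bin_fact (ltnW (ltn_ord k))) !natrM.
by field; rewrite !fact_neq0.
Qed.

Theorem theorem6 (K : fieldType) (charK : [pchar K] =i pred0)
    (B : nat -> K) (hB : is_bernoulli B) (n : nat) (n_gt0 : (0 < n)%N) :
  let x1 := ratfun_x1 K in
  let x2 := ratfun_x2 K in
  (\sum_(0 <= k < n.+1 | k == n %[mod 2])
      'C(n, k)%:R * (x1 - x2) ^+ (n - k)
      * (2 ^+ k * symphi k x1 x2 - 2 * (x1 + x2) ^+ k)
      * ratfun_const (B (n - k)%N)
   = n%:R * 2 ^ (n%:Z - 2) * (x1 - x2) ^+ 2 * symS (n%:Z - 2) x1 x2)
  /\
  (\sum_(0 <= k < n.+1 | k == n %[mod 2])
      'C(n, k)%:R * (x1 - x2) ^+ (n - k) * (1 - 2 ^+ (n - k))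
      * (2 ^+ k * symphi k x1 x2 + 2 * (x1 + x2) ^+ k)
      * ratfun_const (B (n - k)%N)
   = - (n%:R * 2 ^ (n%:Z - 2) * (x1 - x2) ^+ 2 * symS (n%:Z - 2) x1 x2)).
Proof.
move=> x1 x2; pose R := {mpoly K[2]}.
(* The embedding of constants carries the characteristic and the recurrence over to the rational
   functions. *)
pose f : {rmorphism K -> ratfun K} :=
  (@FracField.tofrac R : {rmorphism R -> ratfun K}) \o @mpolyC 2 K.
have charF : [pchar ratfun K] =i pred0.
  by move=> p; rewrite -(charK p) (fmorph_pchar f).
have sumB m : \sum_(k < m) 'C(m, k)%:R * ratfun_const (B k) = (m == 1%N)%:R.
  have := congr1 f (is_bernoulli_sum charK hB m).
  rewrite rmorph_sum rmorph_nat => <-; apply: eq_bigr => k _.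
  by rewrite rmorphM rmorph_nat.
rewrite symS_closed //; split.
  exact: (@bernoulli_sum_diff _ charF (fun k => ratfun_const (B k)) sumB x1 x2 n).
exact: (@bernoulli_sum_add _ charF (fun k => ratfun_const (B k)) sumB x1 x2 n).
Qed.
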